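(* Let $k$ be a field and let $A$ be a finite dimensional symmetric $k$-algebra. Then the tensor product algebra $A\otimes_k k[x]/(x^2)$ is isomorphic, as a $k$-algebra, to the trivial extension algebra $T(A)=A\ltimes D(A)$ of $A$.
   Context: For a finite dimensional $k$-algebra $A$, let $D(A)=\mathrm{Hom}_k(A,k)$ with its natural $A$-$A$-bimodule structure. The algebra $A$ is symmetric if $A\cong D(A)$ as $A$-$A$-bimodules. The trivial extension algebra $T(A)=A\ltimes D(A)$ is the $k$-vector space $A\oplus D(A)$ with multiplication $(a,f)(b,g)=(ab,\,ag+fb)$ for $a,b\in A$ and $f,g\in D(A)$. *)

(* Defs.v *)
From HB Require Import structures.
From mathcomp Require Import all_boot all_algebra.

Set Implicit Arguments.
Unset Strict Implicit.
Unset Printing Implicit Defensive.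

Import GRing.Theory VectorInternalTheory.
Local Open Scope ring_scope.

Reserved Notation "x ** y" (at level 40, left associativity).

(* The library's algType and falgType require 1 != 0. The structure below also
   allows the zero algebra; it carries its own product because a join of
   pzRingType and lmodType cannot be added to the library's hierarchy. *)
HB.mixin Record Vector_isFDAlgebra (k : fieldType) A of Vector k A := {
  fdone : A;
  fdmul : A -> A -> A;
  fdmulA : associative fdmul;
  fdmul1l : left_id fdone fdmul;
  fdmul1r : right_id fdone fdmul;
  fdmulDl : left_distributive fdmul +%R;
  fdmulDr : right_distributive fdmul +%R;
  fdscalerAl : forall (c : k) x y, c *: fdmul x y = fdmul (c *: x) y;
  fdscalerAr : forall (c : k) x y, c *: fdmul x y = fdmul x (c *: y)
}.

#[short(type="fdalgType")]
HB.structure Definition FDAlgebra (k : fieldType) :=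
  {A of Vector k A & Vector_isFDAlgebra k A}.

Bind Scope ring_scope with FDAlgebra.sort.
Arguments fdone {k s}.
Notation "x ** y" := (fdmul x y) : ring_scope.

HB.factory Record Algebra_isFDAlgebra (k : fieldType) A
  of Vector k A & GRing.Algebra k A := {}.
HB.builders Context k A of Algebra_isFDAlgebra k A.
HB.instance Definition _ := Vector_isFDAlgebra.Build k A
  (@mulrA A) (@mul1r A) (@mulr1 A) (@mulrDl A) (@mulrDr A)
  (@scalerAl k A) (@scalerAr k A).
HB.end.

Definition alg_isom (k : fieldType) (A B : fdalgType k) : Prop :=
  exists f : A -> B,
    [/\ linear f, f fdone = fdone, {morph f : x y / x ** y} & bijective f].

(* {poly %/ p} is k[x]/(p) only when p is monic and nonconstant, as 'X^2 is
   (mk_monic_Xn). *)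
HB.instance Definition _ (k : fieldType) (p : {poly k}) :=
  SemiVector.copy {poly %/ p} {poly_(size (mk_monic p)).-1 k}.
HB.instance Definition _ (k : fieldType) (p : {poly k}) :=
  Algebra_isFDAlgebra.Build k {poly %/ p}.

Section TensorSpace.
Variables (k : fieldType) (U V : vectType k).

(* The tensor u (x) v is represented by the outer product of the coordinate
   vectors of u and v. Lemma tens_universal below is the universal property. *)
Definition tensor : Type := 'M[k]_(dim U, dim V).
HB.instance Definition _ := Vector.on tensor.

Definition tens (u : U) (v : V) : tensor := (v2r u)^T *m v2r v.

(* The linear map induced by a bilinear map. *)
Definition tens_lift (W : lmodType k) (b : U -> V -> W) (X : tensor) : W :=
  \sum_i \sum_j X i j *: b (r2v (delta_mx 0 i)) (r2v (delta_mx 0 j)).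

Lemma tens_linear_r u : linear (tens u).
Proof. by move=> c x y; rewrite /tens linearP mulmxDr -scalemxAr. Qed.

Lemma tens_linear_l v : linear (tens^~ v).
Proof.
by move=> c x y; rewrite /tens linearP /= linearP /= mulmxDl -scalemxAl.
Qed.

Lemma tens_lift_linear (W : lmodType k) (b : U -> V -> W) :
  linear (tens_lift b).
Proof.
move=> c X Y; rewrite /tens_lift scaler_sumr -big_split; apply: eq_bigr => i _.
rewrite scaler_sumr -big_split; apply: eq_bigr => j _ /=.
by rewrite !mxE scalerDl scalerA.
Qed.

Lemma v2r_sum (T : vectType k) (u : T) :
  u = \sum_i v2r u 0 i *: r2v (delta_mx 0 i).
Proof.
rewrite -[LHS]v2rK [in LHS](row_sum_delta (v2r u)) linear_sum.
by apply: eq_bigr => i _; rewrite linearZ.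
Qed.

Lemma tens_lift_tens (W : lmodType k) (b : U -> V -> W) :
  (forall u, linear (b u)) -> (forall v, linear (b^~ v)) ->
  forall u v, tens_lift b (tens u v) = b u v.
Proof.
move=> br bl u v.
pose br' u : {linear V -> W} :=
  HB.pack (b u) (GRing.isLinear.Build k V W _ (b u) (br u)).
pose bl' v : {linear U -> W} :=
  HB.pack (b^~ v) (GRing.isLinear.Build k U W _ (b^~ v) (bl v)).
rewrite [in RHS](v2r_sum u) -[RHS]/(bl' v _) linear_sum; apply: eq_bigr => i _.
rewrite linearZ /= [in RHS](v2r_sum v) -[X in _ *: X]/(br' _ _) linear_sum.
rewrite scaler_sumr; apply: eq_bigr => j _.
by rewrite linearZ /= scalerA /tens mxE big_ord1 mxE.
Qed.

Lemma tens_sum (X : tensor) :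
  X = \sum_i \sum_j X i j *: tens (r2v (delta_mx 0 i)) (r2v (delta_mx 0 j)).
Proof.
rewrite [LHS]matrix_sum_delta; apply: eq_bigr => i _; apply: eq_bigr => j _.
by rewrite /tens !r2vK trmx_delta mul_delta_mx.
Qed.

Lemma tens_ext (W : lmodType k) (f g : tensor -> W) :
  linear f -> linear g -> (forall u v, f (tens u v) = g (tens u v)) -> f =1 g.
Proof.
move=> fL gL fg X.
pose f' : {linear tensor -> W} :=
  HB.pack f (GRing.isLinear.Build k tensor W _ f fL).
pose g' : {linear tensor -> W} :=
  HB.pack g (GRing.isLinear.Build k tensor W _ g gL).
rewrite -[f]/(f' : _ -> _) -[g]/(g' : _ -> _) [X]tens_sum !linear_sum.
apply: eq_bigr => i _; rewrite !linear_sum; apply: eq_bigr => j _.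
by rewrite !linearZ /= fg.
Qed.

Lemma tens_universal (W : lmodType k) (b : U -> V -> W) :
  (forall u, linear (b u)) -> (forall v, linear (b^~ v)) ->
  exists f : tensor -> W,
    [/\ linear f, forall u v, f (tens u v) = b u v
      & forall g : tensor -> W,
          linear g -> (forall u v, g (tens u v) = b u v) -> g =1 f].
Proof.
move=> br bl; exists (tens_lift b); split.
- exact: tens_lift_linear.
- exact: tens_lift_tens.
- move=> g gL gb; apply: tens_ext => // [|u v]; first exact: tens_lift_linear.
  by rewrite gb tens_lift_tens.
Qed.

End TensorSpace.

Section TensorAlgebra.
Variables (k : fieldType) (A B : fdalgType k).
Local Notation T := (tensor A B).
Implicit Types X Y Z : T.

Definition tens_one : T := tens fdone fdone.

Definition tens_mul X Y : T :=
  tens_lift (fun a b =>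
    tens_lift (fun a' b' => tens (a ** a') (b ** b')) Y) X.

Lemma tens_mul_linear_l Y : linear (tens_mul^~ Y).
Proof. exact: tens_lift_linear. Qed.

Lemma tens_mul_linear_r X : linear (tens_mul X).
Proof.
move=> c Y Z; rewrite /tens_mul [LHS]/tens_lift [X in _ = c *: X + _]/tens_lift.
rewrite [X in _ = _ + X]/tens_lift scaler_sumr -big_split.
apply: eq_bigr => i _; rewrite scaler_sumr -big_split; apply: eq_bigr => j _ /=.
by rewrite tens_lift_linear scalerDr !scalerA mulrC.
Qed.

Lemma fdmul_linear_l (C : fdalgType k) (y : C) : linear (fdmul^~ y).
Proof. by move=> c u v; rewrite fdmulDl fdscalerAl. Qed.

Lemma fdmul_linear_r (C : fdalgType k) (x : C) : linear (fdmul x).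
Proof. by move=> c u v; rewrite fdmulDr fdscalerAr. Qed.

Lemma tens_mul_tens a b a' b' :
  tens_mul (tens a b) (tens a' b') = tens (a ** a') (b ** b').
Proof.
have inner a0 b0 : tens_lift (fun a' b' => tens (a0 ** a') (b0 ** b'))
    (tens a' b') = tens (a0 ** a') (b0 ** b') :> T.
  rewrite tens_lift_tens // => [u|v] c x y.
    by rewrite fdmul_linear_r tens_linear_r.
  by rewrite fdmul_linear_r tens_linear_l.
rewrite /tens_mul tens_lift_tens ?inner // => [u|v] c x y; rewrite !inner.
  by rewrite (fdmul_linear_l b') tens_linear_r.
by rewrite (fdmul_linear_l a') tens_linear_l.
Qed.

Lemma tens_mulA : associative tens_mul.
Proof.
move=> X Y Z.
apply: (tens_ext (f := fun X => tens_mul X (tens_mul Y Z))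
  (g := fun X => tens_mul (tens_mul X Y) Z)) => [||a b].
- exact: tens_mul_linear_l.
- by move=> c x y; rewrite !tens_mul_linear_l.
apply: (tens_ext (f := fun Y => tens_mul (tens a b) (tens_mul Y Z))
  (g := fun Y => tens_mul (tens_mul (tens a b) Y) Z)) => [||a' b'].
- by move=> c x y; rewrite tens_mul_linear_l tens_mul_linear_r.
- by move=> c x y; rewrite tens_mul_linear_r tens_mul_linear_l.
apply: (tens_ext (f := fun Z => tens_mul (tens a b) (tens_mul (tens a' b') Z))
  (g := fun Z => tens_mul (tens_mul (tens a b) (tens a' b')) Z)) => [||a'' b''].
- by move=> c x y; rewrite !tens_mul_linear_r.
- exact: tens_mul_linear_r.
by rewrite !tens_mul_tens !fdmulA.
Qed.

Lemma tens_mul1 : left_id tens_one tens_mul.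
Proof.
apply: (tens_ext (g := id)) => [||a b] //; first exact: tens_mul_linear_r.
by rewrite tens_mul_tens !fdmul1l.
Qed.

Lemma tens_mulr1 : right_id tens_one tens_mul.
Proof.
apply: (tens_ext (f := tens_mul^~ _) (g := id)) => [||a b] //.
  exact: tens_mul_linear_l.
by rewrite tens_mul_tens !fdmul1r.
Qed.

Lemma tens_mulDl : left_distributive tens_mul +%R.
Proof.
by move=> X Y Z; have := tens_mul_linear_l Z 1 X Y; rewrite !scale1r.
Qed.

Lemma tens_mulDr : right_distributive tens_mul +%R.
Proof.
by move=> X Y Z; have := tens_mul_linear_r X 1 Y Z; rewrite !scale1r.
Qed.

Lemma tens_scalerAl (c : k) X Y : c *: tens_mul X Y = tens_mul (c *: X) Y.
Proof.
have t0 : tens_mul 0 Y = 0.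
  by apply: (addrI (tens_mul 0 Y)); rewrite -tens_mulDl !addr0.
by have := tens_mul_linear_l Y c X 0; rewrite /= t0 !addr0.
Qed.

Lemma tens_scalerAr (c : k) X Y : c *: tens_mul X Y = tens_mul X (c *: Y).
Proof.
have t0 : tens_mul X 0 = 0.
  by apply: (addrI (tens_mul X 0)); rewrite -tens_mulDr !addr0.
by have := tens_mul_linear_r X c Y 0; rewrite /= t0 !addr0.
Qed.

HB.instance Definition _ :=
  Vector_isFDAlgebra.Build k T
  tens_mulA tens_mul1 tens_mulr1 tens_mulDl tens_mulDr
  tens_scalerAl tens_scalerAr.

End TensorAlgebra.

Section Dual.
Variables (k : fieldType) (A : fdalgType k).

Implicit Types (a b x : A) (f g : 'Hom(A, k^o)).

Definition dual_lact a f : 'Hom(A, k^o) := linfun (fun x => f (x ** a)).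
Definition dual_ract f b : 'Hom(A, k^o) := linfun (fun x => f (b ** x)).

Lemma dual_lactE a f x : dual_lact a f x = f (x ** a).
Proof.
have fL : linear (fun x => f (x ** a) : k^o).
  by move=> c u v; rewrite fdmul_linear_l linearP.
pose g : {linear A -> k^o} :=
  HB.pack (fun x => f (x ** a)) (GRing.isLinear.Build k A k^o _ _ fL).
exact: (lfunE g).
Qed.

Lemma dual_ractE f b x : dual_ract f b x = f (b ** x).
Proof.
have fL : linear (fun x => f (b ** x) : k^o).
  by move=> c u v; rewrite fdmul_linear_r linearP.
pose g : {linear A -> k^o} :=
  HB.pack (fun x => f (b ** x)) (GRing.isLinear.Build k A k^o _ _ fL).
exact: (lfunE g).
Qed.

Definition symmetric_algebra : Prop :=
  exists phi : A -> 'Hom(A, k^o),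
    [/\ linear phi, bijective phi
      & forall a x b, phi (a ** x ** b) = dual_ract (dual_lact a (phi x)) b].

End Dual.

Section TrivialExtension.
Variables (k : fieldType) (A : fdalgType k).

Definition trivext : Type := (A * 'Hom(A, k^o))%type.
HB.instance Definition _ := Vector.on trivext.

Implicit Types u v w : trivext.

Definition trivext_one : trivext := (fdone, 0).

Definition trivext_mul u v : trivext :=
  (u.1 ** v.1, dual_lact u.1 v.2 + dual_ract u.2 v.1).

Let dualE := (dual_lactE, dual_ractE, add_lfunE, scale_lfunE, zero_lfunE).

Lemma trivext_mulA : associative trivext_mul.
Proof.
move=> u v w; congr pair => /=; first exact: fdmulA.
by apply/lfunP => x; rewrite !dualE !fdmulA addrA.
Qed.

Lemma trivext_mul1 : left_id trivext_one trivext_mul.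
Proof.
move=> [a f]; congr pair => /=; first exact: fdmul1l.
by apply/lfunP => x; rewrite !dualE fdmul1r addr0.
Qed.

Lemma trivext_mulr1 : right_id trivext_one trivext_mul.
Proof.
move=> [a f]; congr pair => /=; first exact: fdmul1r.
by apply/lfunP => x; rewrite !dualE fdmul1l add0r.
Qed.

Lemma trivext_mulDl : left_distributive trivext_mul +%R.
Proof.
move=> u v w; congr pair => /=; first exact: fdmulDl.
by apply/lfunP => x; rewrite !dualE fdmulDr linearD addrACA.
Qed.

Lemma trivext_mulDr : right_distributive trivext_mul +%R.
Proof.
move=> u v w; congr pair => /=; first exact: fdmulDr.
by apply/lfunP => x; rewrite !dualE fdmulDl linearD addrACA.
Qed.

Lemma trivext_scalerAl (c : k) u v :
  c *: trivext_mul u v = trivext_mul (c *: u) v.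
Proof.
congr pair => /=; first exact: fdscalerAl.
by apply/lfunP => x; rewrite !dualE -fdscalerAr linearZ scalerDr.
Qed.

Lemma trivext_scalerAr (c : k) u v :
  c *: trivext_mul u v = trivext_mul u (c *: v).
Proof.
congr pair => /=; first exact: fdscalerAr.
by apply/lfunP => x; rewrite !dualE -fdscalerAl linearZ scalerDr.
Qed.

HB.instance Definition _ :=
  Vector_isFDAlgebra.Build k trivext
  trivext_mulA trivext_mul1 trivext_mulr1 trivext_mulDl trivext_mulDr
  trivext_scalerAl trivext_scalerAr.

End TrivialExtension.

(* Main.v *)
(* A bimodule isomorphism phi : A -> D(A) turns
   A (x) k[x]/(x^2) = A (+) A x into A (+) D(A) through
   a + b x |-> (a, phi b). Multiplicativity is the product rule
   (a + b x)(c + d x) = ac + (ad + bc) x together with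
   phi (ad + bc) = a (phi d) + (phi b) c. *)

Require Import Defs.
From HB Require Import structures.
From mathcomp Require Import all_boot all_algebra.
Local Open Scope ring_scope.

Import GRing.Theory.

Section QuotientByXn.
Variables (k : fieldType) (n : nat).
Local Notation Q := {poly %/ ('X^(n.+1) : {poly k})}.

(** Reduction modulo ['X^(n.+1)] is truncation, so coefficients of degree at most n survive it. *)
Lemma coef_qpolyXn_mul (p q : Q) (i : nat) : (i < n.+1)%N ->
  (p ** q : Q)`_i = ((p : {poly k}) * (q : {poly k}))`_i.
Proof.
move=> ltin; rewrite -[p ** q]/(p * q) poly_of_qpolyM.
rewrite [X in Pdiv.CommonRing.rmodp _ X]mk_monic_Xn.
by rewrite -Pdiv.RingMonic.take_poly_rmodp coef_take_poly ltin.
Qed.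

Lemma size_qpolyXn (p : Q) : (size (p : {poly k}) <= n.+1)%N.
Proof.
apply: leq_trans (size_npoly p) _.
by rewrite mk_monic_Xn size_polyXn.
Qed.

End QuotientByXn.

Local Notation dual_numbers k := {poly %/ ('X^2 : {poly k})}.

Lemma qpolyX2_X (k : fieldType) : ('qX : dual_numbers k) = 'X :> {poly k}.
Proof. by apply: qpolyXE; rewrite ?size_polyXn ?monicXn. Qed.

Lemma qpolyX2E (k : fieldType) (p : dual_numbers k) :
  p = (p : {poly k})`_0 *: (fdone : dual_numbers k)
      + (p : {poly k})`_1 *: ('qX : dual_numbers k).
Proof.
apply: val_inj; apply/polyP => i.
rewrite -[val (_ + _)]/(_ *: 1%:P + _ *: polyn ('qX : dual_numbers k)).
rewrite qpolyX2_X coefD !coefZ coefC coefX.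
case: i => [|[|i]]; rewrite ?(mulr0, mulr1, addr0, add0r) //.
(* From degree 2 on, both sides vanish: the representative of [p] has size at most 2. *)
by rewrite nth_default // (leq_trans (size_qpolyXn _ _ p)).
Qed.

Theorem proposition1p5 (k : fieldType) (A : fdalgType k) :
  symmetric_algebra A ->
  alg_isom (tensor A {poly %/ ('X^2 : {poly k})}) (trivext A).
Proof.
move=> [phi [phiL [psi phiK psiK] phiB]].
have phiZ : scalable phi by apply: GRing.scalable_linear.
have phiD a b : phi (a + b) = phi a + phi b.
  by have := phiL 1 a b; rewrite !scale1r.
(* One-sided linearity comes from the bimodule identity with the other outer factor set to 1. *)
have phi_l a b : phi (a ** b) = dual_lact a (phi b).
  have := phiB a b fdone; rewrite fdmul1r => ->.
  by apply/lfunP => x; rewrite dual_ractE fdmul1l.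
have phi_r a b : phi (a ** b) = dual_ract (phi a) b.
  have := phiB fdone a b; rewrite fdmul1l => ->.
  by apply/lfunP => x; rewrite !dual_ractE dual_lactE fdmul1r.
have psiL : linear psi.
  by move=> c f g; apply: (can_inj phiK); rewrite phiD phiZ !psiK.
pose b (a : A) (p : dual_numbers k) : trivext A :=
  ((p : {poly k})`_0 *: a, (p : {poly k})`_1 *: phi a).
have b_r a : linear (b a).
  by move=> c p q; congr pair => /=; rewrite coefD coefZ scalerDl scalerA.
have b_l p : linear (b^~ p).
  move=> c u v; congr pair => /=; rewrite ?phiD ?phiZ scalerDr !scalerA;
  by rewrite [_ * c]mulrC.
pose F := tens_lift b.
(* The inverse of [F]: (a, f) goes to a (x) 1 + psi f (x) x. *)
pose G (u : trivext A) : tensor A (dual_numbers k) :=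
  tens u.1 fdone + tens (psi u.2) 'qX.
have FL : linear F by apply: tens_lift_linear.
have FE : forall u v, F (tens u v) = b u v by apply: tens_lift_tens.
have GL : linear G.
  move=> c u v; rewrite /G /= psiL !(tens_linear_l _) scalerDr.
  by rewrite addrACA.
exists F; split => //.
- by rewrite FE /b qpolyCE !coefC /= scale1r scale0r.
- have FM (X Y : tensor A (dual_numbers k)) :
      F (tens_mul X Y) = trivext_mul (F X) (F Y).
    have TL v : linear (trivext_mul (A := A) ^~ v) by apply: fdmul_linear_l.
    have TR u : linear (trivext_mul (A := A) u) by apply: fdmul_linear_r.
    (* Both sides are linear in [X] and in [Y], so pure tensors suffice. *)
    apply: (tens_ext (f := fun X => F (tens_mul X Y))
      (g := fun X => trivext_mul (F X) (F Y))) => [c x y|c x y|a p].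
    + by rewrite tens_mul_linear_l FL.
    + by rewrite FL TL.
    apply: (tens_ext (f := fun Y => F (tens_mul (tens a p) Y))
      (g := fun Y => trivext_mul (F (tens a p)) (F Y))) => [c x y|c x y|a' p'].
    + by rewrite tens_mul_linear_r FL.
    + by rewrite FL TR.
    rewrite tens_mul_tens !FE /b /trivext_mul /=.
    rewrite !coef_qpolyXn_mul // coefM big_ord1 coefM big_ord_recl big_ord1 /=.
    congr pair; first by rewrite -fdscalerAl -fdscalerAr scalerA.
    (* Both dual terms become multiples of [phi (a ** a')], with scalars p_0 p'_1 and p_1 p'_0,
       which add up to the coefficient of x in p p'. *)
    rewrite -!phiZ -phi_l -phi_r -!(fdscalerAl, fdscalerAr) !phiZ !scalerA.
    by rewrite -scalerDl.
  exact: FM.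
- exists G => [X|[a f]].
  + apply: (tens_ext (f := fun X => G (F X)) (g := id)) => // [c x y|a p].
      by rewrite FL GL.
    rewrite FE /G /b /= -phiZ phiK.
    (* Moving scalars across the tensor sign turns p_0 a (x) 1 + p_1 a (x) x into a (x) (p_0 + p_1
       x). *)
    have tZ c (u : A) (q : dual_numbers k) : tens (c *: u) q = tens u (c *: q).
      transitivity (c *: tens u q).
        exact: (GRing.scalable_linear (tens_linear_l q)).
      by symmetry; apply: (GRing.scalable_linear (tens_linear_r u)).
    (* The factor 1 gives the sum the shape [c *: x + y] that linearity expects. *)
    by rewrite !tZ -[X in X + _]scale1r -tens_linear_r scale1r -qpolyX2E.
  + have FD x y : F (x + y) = F x + F y by have := FL 1 x y; rewrite !scale1r.
    rewrite /G FD !FE /b psiK qpolyX2_X qpolyCE !coefC !coefX /=.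
    by rewrite !scale0r !scale1r; congr pair; rewrite ?addr0 ?add0r.
Qed.
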